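(* Let $(X,\sigma,\tau)$ be an indecomposable solution of multipermutation level $2$. Then the automorphism group of the solution $(X,\sigma,\tau)$ is regular, i.e. it acts regularly (transitively with trivial point stabilizers) on $X$.
   Context: A solution $(X,\sigma,\tau)$ is a nonempty set $X$ (of arbitrary cardinality) with families of bijections $\sigma_x,\tau_x:X\to X$ ($x\in X$) such that $r(x,y)=(\sigma_x(y),\tau_y(x))$ satisfies $(\mathrm{id}\times r)(r\times\mathrm{id})(\mathrm{id}\times r)=(r\times\mathrm{id})(\mathrm{id}\times r)(r\times\mathrm{id})$ on $X^3$. It is indecomposable if $\langle\sigma_x,\tau_x: x\in X\rangle$ acts transitively on $X$. Put $x\approx y$ iff $\sigma_x=\sigma_y$ and $\tau_x=\tau_y$. The operations induced on $X/{\approx}$ are well defined and give a solution $\mathrm{Ret}(X)$. $X$ is a permutation solution (multipermutation level $1$) if $|\mathrm{Ret}(X)|=1$; it has multipermutation level $2$ if it is not a permutation solution and $|\mathrm{Ret}(\mathrm{Ret}(X))|=1$. An automorphism of $(X,\sigma,\tau)$ is a bijection $\Phi:X\to X$ with $\Phi\sigma_x=\sigma_{\Phi(x)}\Phi$ and $\Phi\tau_x=\tau_{\Phi(x)}\Phi$ for all $x\in X$. *)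

(* Defs.v *)
(* Carriers are arbitrary types; {classic X} supplies the choice structure that
   the MathComp quotient {eq_quot _} requires. *)
From HB Require Import structures.
From mathcomp Require Import all_boot generic_quotient.
From mathcomp Require Import boolp classical_sets.

Set Implicit Arguments.
Unset Strict Implicit.
Unset Printing Implicit Defensive.

Local Open Scope quotient_scope.

Section BraidMap.
Context {X : Type} (s t : X -> X -> X).

Definition braid_map (p : X * X) : X * X := (s p.1 p.2, t p.2 p.1).

Definition map_r_id (p : X * X * X) : X * X * X :=
  let: (x, y, z) := p in let: (x', y') := braid_map (x, y) in (x', y', z).

Definition map_id_r (p : X * X * X) : X * X * X :=
  let: (x, y, z) := p in let: (y', z') := braid_map (y, z) in (x, y', z').

Definition yang_baxter : Prop := forall p,
  map_id_r (map_r_id (map_id_r p)) = map_r_id (map_id_r (map_r_id p)).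

End BraidMap.

Record solution := Solution {
  carrier :> Type;
  sigma : carrier -> carrier -> carrier;
  tau : carrier -> carrier -> carrier;
  carrier_inhabited : inhabited carrier;
  sigma_bij : forall x, bijective (sigma x);
  tau_bij : forall x, bijective (tau x);
  sigma_tau_yang_baxter : yang_baxter sigma tau }.

Arguments sigma {s} x y : rename.
Arguments tau {s} x y : rename.

(* The smallest set of maps containing G and closed under composition and
   inverses of bijections: for G made of bijections, the subgroup of Sym(X)
   generated by G. *)
Inductive generated_group {X : Type} (G : set (X -> X)) : set (X -> X) :=
| GenOf f : G f -> generated_group G f
| GenId : generated_group G id
| GenComp f g :
    generated_group G f -> generated_group G g -> generated_group G (f \o g)
| GenInv f g :
    generated_group G f -> cancel f g -> cancel g f -> generated_group G g.

Definition acts_transitively {X : Type} (G : set (X -> X)) : Prop :=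
  forall x y : X, exists2 g, G g & g x = y.

Definition acts_regularly {X : Type} (G : set (X -> X)) : Prop :=
  acts_transitively G /\ (forall x g, G g -> g x = x -> g = id).

Definition indecomposable (S : solution) : Prop :=
  acts_transitively (generated_group
    (fun f : S -> S => exists x : S, f = sigma x \/ f = tau x)).

Definition automorphisms (S : solution) : set (S -> S) := fun Phi =>
  [/\ bijective Phi,
      forall x, Phi \o sigma x = sigma (Phi x) \o Phi &
      forall x, Phi \o tau x = tau (Phi x) \o Phi].
Arguments automorphisms S : clear implicits.

(* The lemmas that follow, up to the end of Section Retraction, show that the
   operations of a solution and their inverses are compatible with the
   retraction relation, without assuming that r is invertible. *)

(* The Yang-Baxter equation in coordinates, with the inverses s' x and t' x of
   the bijections s x and t x. *)
Record nondegenerate_ybe {X : Type} (s t s' t' : X -> X -> X) : Prop := NYbe {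
  nybe_sK : forall x, cancel (s x) (s' x);
  nybe_s'K : forall x, cancel (s' x) (s x);
  nybe_tK : forall x, cancel (t x) (t' x);
  nybe_t'K : forall x, cancel (t' x) (t x);
  nybe_s : forall x y z, s x (s y z) = s (s x y) (s (t y x) z);
  nybe_st : forall x y z,
    t (s (t y x) z) (s x y) = s (t (s y z) x) (t z y);
  nybe_t : forall x y z, t z (t y x) = t (t z y) (t (s y z) x) }.

Lemma nybe_sym {X : Type} (s t s' t' : X -> X -> X) :
  nondegenerate_ybe s t s' t' -> nondegenerate_ybe t s t' s'.
Proof. by case=> *; split. Qed.

(* The diagonal maps U x = s_x^-1 x and T x = t_x^-1 x, and the maps
   P x = s_(T x) x and Q x = t_(U x) x, which turn out to be their inverses. *)
Definition diag {X : Type} (s' : X -> X -> X) x := s' x x.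
Definition codiag {X : Type} (s t' : X -> X -> X) x := s (diag t' x) x.

Section Diagonal.
Context {X : Type} (s t s' t' : X -> X -> X) (N : nondegenerate_ybe s t s' t').

Local Notation U := (diag s').
Local Notation T := (diag t').
Local Notation P := (codiag s t').
Local Notation Q := (codiag t s').

Lemma diagK x : s x (U x) = x.
Proof. exact: (nybe_s'K N). Qed.

Lemma diagP x y : s x y = x -> U x = y.
Proof. by move=> sxy; rewrite -[RHS](nybe_sK N x) sxy. Qed.

Lemma codiagK x : U (P x) = x.
Proof.
apply: diagP; have := nybe_s N (T x) x (U x).
by rewrite diagK [t x _](nybe_t'K N) diagK => <-.
Qed.

Lemma diag_s x y : U (s x y) = s (t y x) (U y).
Proof. by apply: diagP; rewrite -(nybe_s N) diagK. Qed.

Lemma s_codiag x z : s (Q x) z = s (U x) z.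
Proof.
apply: (can_inj (nybe_sK N x)).
by rewrite [RHS](nybe_s N) diagK.
Qed.

Lemma diag_t x y : U (t x y) = t (s' (U y) x) (U y).
Proof.
apply: diagP; have := nybe_st N y (U y) (s' (U y) x).
by rewrite (nybe_s'K N) diagK -/(Q y) s_codiag (nybe_s'K N) => <-.
Qed.

Lemma diag_codiagC x : U (Q x) = Q (U x).
Proof. by rewrite /codiag diag_t. Qed.

End Diagonal.

Section DiagonalBijective.
Context {X : Type} (s t s' t' : X -> X -> X) (N : nondegenerate_ybe s t s' t').
Let M := nybe_sym N.

Local Notation U := (diag s').
Local Notation T := (diag t').
Local Notation P := (codiag s t').
Local Notation Q := (codiag t s').

Lemma codiag_s x y : P (s x y) = s (t' (T y) x) (P y).
Proof.
rewrite {1}/codiag (diag_t M); set x' := t' (T y) x.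
by rewrite (nybe_s N x') (nybe_t'K N).
Qed.

Lemma codiag_t x y : P (t x y) = t (s y x) (P y).
Proof. by rewrite /codiag (diag_s M) -(nybe_st N) (diagK M). Qed.

Lemma s_diag_codiag x z : s (T x) z = s (P x) z.
Proof.
set b := T (P x).
have tb : t (T x) b = P x by rewrite -(s_codiag M) (diagK M).
have sb : s b (T x) = b.
  have PE : s (P x) x = P x by rewrite -{2}[x](codiagK N) (diagK N).
  transitivity (T (s (P x) x)); last by rewrite PE.
  rewrite (diag_t M); congr (s _ _).
  by apply: (can_inj (nybe_tK N (T x))); rewrite (nybe_t'K N).
by apply: (can_inj (nybe_sK N b)); rewrite (nybe_s N) sb tb.
Qed.

Lemma codiag_diag_t x y : P (U (t x y)) = t x (P (U y)).
Proof. by rewrite (diag_t N) codiag_t (nybe_s'K N). Qed.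

End DiagonalBijective.

Section Retraction.
Context {X : Type} (s t s' t' : X -> X -> X) (N : nondegenerate_ybe s t s' t').
Let M := nybe_sym N.

Local Notation U := (diag s').
Local Notation T := (diag t').
Local Notation P := (codiag s t').
Local Notation Q := (codiag t s').

Lemma codiagC x : Q (P x) = P (Q x).
Proof.
have PE z : P z = s (T z) z by [].
have QTP z : Q (T (P z)) = P (Q (T z)).
  by rewrite PE (codiag_diag_t M) PE (codiagK M).
have {}QTP z : Q (P (T z)) = P (Q (T z)) by rewrite -QTP (diag_codiagC M).
by have := QTP (Q x); rewrite (codiagK M).
Qed.

Lemma diagK' x : P (U x) = x.
Proof.
pose S x := P (Q x).
have sS z w : s (S z) w = s z w.
  by rewrite -(s_diag_codiag N) (codiagK M).
have tS z w : t (S z) w = t z w.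
  by rewrite /S -codiagC -(s_diag_codiag M) (codiagK N).
have S_s z w : S (s z w) = s z (S w).
  rewrite /S -codiagC (codiag_s N) (codiag_t M).
  by rewrite (s_codiag M) (nybe_t'K N) codiagC.
have S_t z w : S (t z w) = t z (S w).
  by rewrite /S (codiag_s M) (codiag_t N) (s_codiag N) (nybe_s'K N).
have US z : U (S z) = S (U z).
  by apply: (diagP N); rewrite sS -S_s (diagK N).
have TS z : T (S z) = S (T z).
  by apply: (diagP M); rewrite tS -S_t (diagK M).
have UTS z : U (T (S z)) = z by rewrite /S -codiagC (codiagK M) (codiagK N).
have {UTS}SUT z : P (Q (U (T z))) = z by rewrite -/(S _) -US -TS UTS.
by rewrite -(SUT x) (codiagK N).
Qed.

Lemma diag_inj : injective U.
Proof. exact: can_inj diagK'. Qed.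

Lemma diag_t_s u a p :
  U (t (s (t p a) u) (s a p)) = s (t u (t p a)) (U (t u p)).
Proof. by rewrite (nybe_st N) (diag_s N) -(nybe_t N). Qed.

Lemma t_diag_codiag z u : t u z = U (t (s z u) (P z)).
Proof.
have := diag_t_s u (T z) z.
by rewrite (diagK M) (diagK N) => ->.
Qed.

Let eqv x y := s x = s y /\ t x = t y.

Lemma eqv_s z u v : eqv u v -> eqv (s z u) (s z v).
Proof.
move=> [su tu]; split; apply/funext => y.
  have sE w : s (s z w) y = s z (s w (s' (t w z) y)).
    by rewrite (nybe_s N) (nybe_s'K N).
  by rewrite !sE su tu.
pose p := P (s' z (U y)); pose a := t' p z.
have tpa : t p a = z by rewrite (nybe_t'K N).
have sap : s a p = y.
  by apply: diag_inj; rewrite (diag_s N) tpa (codiagK N) (nybe_s'K N).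
apply: diag_inj; rewrite -sap -tpa !diag_t_s.
by rewrite tu.
Qed.

Lemma eqv_s' z u v : eqv u v -> eqv (s' z u) (s' z v).
Proof.
move=> [su tu].
have tE : t (s' z u) z = t (s' z v) z.
  by rewrite t_diag_codiag [RHS]t_diag_codiag !(nybe_s'K N) tu.
split; apply/funext => y.
  apply: (can_inj (nybe_sK N z)); rewrite !(nybe_s N z) tE.
  by rewrite !(nybe_s'K N) su.
pose a := t' y z; have tya : t y a = z by rewrite (nybe_t'K N).
apply: diag_inj; apply: (can_inj (nybe_sK N (t (s' z u) z))).
rewrite {2}tE -tya -!diag_t_s.
by rewrite tya !(nybe_s'K N) tu.
Qed.

End Retraction.

Section Retract.
Variable S : solution.

Definition retract_rel (x y : {classic S}) : bool :=
  `[< sigma x = sigma y /\ tau x = tau y >].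

Lemma retract_rel_refl : reflexive retract_rel.
Proof. by move=> x; apply/asboolP. Qed.

Lemma retract_rel_sym : symmetric retract_rel.
Proof. by move=> x y; apply: asbool_equiv_eq; split=> -[-> ->]. Qed.

Lemma retract_rel_trans : transitive retract_rel.
Proof. by rewrite /retract_rel => y x z /asboolP[-> ->]. Qed.

Canonical retract_equiv_rel :=
  EquivRel retract_rel retract_rel_refl retract_rel_sym retract_rel_trans.

Definition retract_carrier : Type := {eq_quot retract_equiv_rel}.

Definition retract_pi (x : S) : retract_carrier :=
  \pi_{eq_quot retract_equiv_rel} (x : {classic S}).

Definition retract_repr (a : retract_carrier) : S := repr a.

(* Computed on chosen representatives; retract_sigmaE and retract_tauE below show
   that the choice is irrelevant. *)
Definition retract_sigma (a b : retract_carrier) : retract_carrier :=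
  retract_pi (sigma (retract_repr a) (retract_repr b)).

Definition retract_tau (a b : retract_carrier) : retract_carrier :=
  retract_pi (tau (retract_repr a) (retract_repr b)).

Lemma retract_reprK : cancel retract_repr retract_pi.
Proof. exact: reprK. Qed.

Lemma retract_piP (x y : S) :
  retract_pi x = retract_pi y <-> sigma x = sigma y /\ tau x = tau y.
Proof.
split=> [/eqquotP/asboolP //|h].
by apply/eqquotP/asboolP.
Qed.

Lemma retract_repr_pi (x : S) :
  sigma (retract_repr (retract_pi x)) = sigma x /\
  tau (retract_repr (retract_pi x)) = tau x.
Proof. by apply/retract_piP; rewrite retract_reprK. Qed.

Lemma solution_nybe :
  exists s' t', nondegenerate_ybe (@sigma S) (@tau S) s' t'.
Proof.
have [s' s'P] := @choice S (S -> S)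
  (fun x g => cancel (sigma x) g /\ cancel g (sigma x))
  (fun x => let: Bijective g gK Kg := sigma_bij x in ex_intro _ g (conj gK Kg)).
have [t' t'P] := @choice S (S -> S)
  (fun x g => cancel (tau x) g /\ cancel g (tau x))
  (fun x => let: Bijective g gK Kg := tau_bij x in ex_intro _ g (conj gK Kg)).
exists s', t'; split; try by move=> x; case: (s'P x); case: (t'P x).
- by move=> x y z; case: (sigma_tau_yang_baxter (x, y, z)).
- by move=> x y z; case: (sigma_tau_yang_baxter (x, y, z)).
- by move=> x y z; case: (sigma_tau_yang_baxter (x, y, z)).
Qed.

Lemma retract_sigmaE (x y : S) :
  retract_sigma (retract_pi x) (retract_pi y) = retract_pi (sigma x y).
Proof.
have [s' [t' N]] := solution_nybe.
rewrite /retract_sigma (proj1 (retract_repr_pi x)).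
by apply/retract_piP; apply: (eqv_s N); apply: retract_repr_pi.
Qed.

Lemma retract_tauE (x y : S) :
  retract_tau (retract_pi x) (retract_pi y) = retract_pi (tau x y).
Proof.
have [s' [t' N]] := solution_nybe.
rewrite /retract_tau (proj2 (retract_repr_pi x)).
apply/retract_piP/and_comm; apply: (eqv_s (nybe_sym N)).
by apply/and_comm; apply: retract_repr_pi.
Qed.

Lemma retract_inhabited : inhabited retract_carrier.
Proof. by have [x] := carrier_inhabited S; exists; exact: retract_pi x. Qed.

Lemma retract_sigma_bij a : bijective (retract_sigma a).
Proof.
have [s' [t' N]] := solution_nybe.
rewrite -[a]retract_reprK; move: (retract_repr a) => x.
exists (fun b => retract_pi (s' x (retract_repr b))) => b.
  rewrite -[b in LHS]retract_reprK retract_sigmaE -[RHS]retract_reprK.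
  apply/retract_piP; rewrite -{2 4}[retract_repr b](nybe_sK N x).
  by apply: (eqv_s' N); apply: retract_repr_pi.
by rewrite retract_sigmaE (nybe_s'K N) retract_reprK.
Qed.

Lemma retract_tau_bij a : bijective (retract_tau a).
Proof.
have [s' [t' N]] := solution_nybe.
rewrite -[a]retract_reprK; move: (retract_repr a) => x.
exists (fun b => retract_pi (t' x (retract_repr b))) => b.
  rewrite -[b in LHS]retract_reprK retract_tauE -[RHS]retract_reprK.
  apply/retract_piP/and_comm; rewrite -{2 4}[retract_repr b](nybe_tK N x).
  apply: (eqv_s' (nybe_sym N)).
  by apply/and_comm; apply: retract_repr_pi.
by rewrite retract_tauE (nybe_t'K N) retract_reprK.
Qed.

Lemma retract_yang_baxter : yang_baxter retract_sigma retract_tau.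
Proof.
move=> [[a b] c]; rewrite -[a]retract_reprK -[b]retract_reprK -[c]retract_reprK.
move: (retract_repr a) (retract_repr b) (retract_repr c) => x y z.
have [s' [t' N]] := solution_nybe.
rewrite /= !(retract_sigmaE, retract_tauE).
by rewrite (nybe_s N x y z) (nybe_st N x y z) (nybe_t N x y z).
Qed.

Definition Ret : solution :=
  Solution retract_inhabited retract_sigma_bij retract_tau_bij
           retract_yang_baxter.

End Retract.

Definition one_element (X : Type) : Prop := exists a : X, forall b : X, b = a.

Definition permutation_solution (S : solution) : Prop := one_element (Ret S).

Definition multipermutation_level_2 (S : solution) : Prop :=
  ~ permutation_solution S /\ one_element (Ret (Ret S)).

(* Main.v *)
From mathcomp Require Import all_boot.
From mathcomp Require Import boolp classical_sets.
Require Import Defs.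

(** If [Ret (Ret S)] is a point, all the maps [sigma x] induce one permutation
    [L] of [Ret S], and all the maps [tau x] one permutation [R].  The
    Yang-Baxter equation then forces [R] to be the inverse of [L]
    ([retract_LK], [retract_RK]).

    Because of this, the equation
    [sigma_u sigma_w = sigma_(L w) sigma_(R u)], indices being classes, says
    that the index of [sigma] moves along with the class of the argument: for
    every map [a] of [Ret S] commuting with [L], the map [x |-> sigma_(a [x]) x] is an automorphism
    ([twist_automorphism]), and by left-right symmetry so is
    [x |-> tau_(a [x]) x].  When [S] is indecomposable, the powers of [L] carry
    the class of [x] to the class of any [z] ([exists_commuting_map]), so
    [sigma_z x] and [tau_z x] always lie in the orbit of [x] under
    automorphisms.  An orbit stable under all [sigma_z] and [tau_z] and their
    inverses is the whole of [S], which gives transitivity.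

    For freeness, an automorphism with a fixed point acts on [Ret S] as a map
    commuting with the transitive action of [L], hence trivially.  It therefore
    commutes with every [sigma_z] and [tau_z], so its fixed points are stable
    under these and again fill [S]. *)

Set Implicit Arguments.
Unset Strict Implicit.
Unset Printing Implicit Defensive.

(** * Propagation from the generators *)

Lemma generated_group_invariant {X : Type} (G : set (X -> X)) (A : X -> Prop) :
  (forall f, G f -> forall y, A (f y) <-> A y) ->
  forall g, generated_group G g -> forall y, A (g y) <-> A y.
Proof.
move=> GA g; elim=> {g} [f /GA //|//|f g _ IHf _ IHg y|f g _ IHf _ gK y].
  by rewrite /= IHf IHg.
by rewrite -{2}[y]gK IHf.
Qed.

(** Indecomposability as an induction principle. The equivalences, rather than
    implications, account for the inverses in the generated group. *)
Lemma indecomposable_ind (S : solution) (A : S -> Prop) (x : S) :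
  indecomposable S ->
  (forall z y, A (sigma z y) <-> A y) -> (forall z y, A (tau z y) <-> A y) ->
  A x -> forall y, A y.
Proof.
move=> indec As At Ax y; have [g Gg <-] := indec x y.
apply/(generated_group_invariant (A := A) _ Gg) => // f [z [] ->] u.
  exact: As.
exact: At.
Qed.

(** * Solutions whose retract is a permutation solution *)

(** The retraction [p : X -> Y], with a section [q], of a solution whose
    retract is a permutation solution with permutations [L] and [R].  Stated for
    bare operations so that exchanging [s] with [t] gives an instance again. *)
Record retracts_to_permutation {X Y : Type} (s t : X -> X -> X)
    (p : X -> Y) (q : Y -> X) (L R : Y -> Y) : Prop := RetractsToPermutation {
  retractE : forall x y, p x = p y <-> s x = s y /\ t x = t y;
  retract_section : cancel q p;
  retract_s : forall x y, p (s x y) = L (p y);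
  retract_t : forall x y, p (t x y) = R (p y) }.

Lemma retracts_to_permutation_sym {X Y : Type} (s t : X -> X -> X)
    (p : X -> Y) (q : Y -> X) (L R : Y -> Y) :
  retracts_to_permutation s t p q L R -> retracts_to_permutation t s p q R L.
Proof.
case=> pE qK ps pt; split=> // x y.
by rewrite pE; apply: and_comm.
Qed.

(** [x |-> s_(a [x]) x]: each class is moved by one of the maps [s z]. *)
Definition twist {X Y : Type} (s : X -> X -> X) (p : X -> Y) (q : Y -> X)
    (a : Y -> Y) (x : X) : X := s (q (a (p x))) x.

Section PermutationRetract.
Context {X Y : Type} (s t s' t' : X -> X -> X) (N : nondegenerate_ybe s t s' t').
Context (p : X -> Y) (q : Y -> X) (L R : Y -> Y).
Context (H : retracts_to_permutation s t p q L R).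

Lemma eq_retract_s x y : p x = p y -> s x = s y.
Proof. by move/(retractE H) => []. Qed.

Lemma eq_retract_t x y : p x = p y -> t x = t y.
Proof. by move/(retractE H) => []. Qed.

(** With [u = s_w w], both [u] and [s_u w] lie in the class [L [w]], so
    [s_u s_w = s_(s_u w) s_(t_w u)] can be cancelled on the left. *)
Lemma s_of_t_s w : s (t w (s w w)) = s w.
Proof.
have sE : s (s (s w w) w) = s (s w w).
  by apply: eq_retract_s; rewrite !(retract_s H).
apply/funext => z; apply: (can_inj (nybe_sK N (s w w))).
by rewrite [RHS](nybe_s N) sE.
Qed.

Lemma retract_LRC c : L (R c) = R (L c).
Proof.
set w := q c; rewrite -[c](retract_section H) -/w.
by have /(congr1 p) := nybe_st N w w w; rewrite !(retract_s H, retract_t H).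
Qed.

End PermutationRetract.

Section PermutationRetractInverse.
Context {X Y : Type} (s t s' t' : X -> X -> X) (N : nondegenerate_ybe s t s' t').
Context (p : X -> Y) (q : Y -> X) (L R : Y -> Y).
Context (H : retracts_to_permutation s t p q L R).

(** [s_of_t_s] shows that [s] is the same at [R (L c)] and [c]; its mirror
    image shows that [t] is the same at [L (R c)] and [c].  As [L] and [R]
    commute, the two classes [R (L c)] and [c] are not separated by the
    operations. *)
Lemma retract_LK : cancel L R.
Proof.
move=> c; set w := q c.
have pw : p w = c by apply: (retract_section H).
rewrite -pw -(retract_s H w) -(retract_t H w).
apply/(retractE H); split; first exact: (s_of_t_s N H).
rewrite -(s_of_t_s (nybe_sym N) (retracts_to_permutation_sym H) w).
apply: (eq_retract_t H); rewrite !(retract_s H, retract_t H).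
by rewrite (retract_LRC N H).
Qed.

Lemma retract_RK : cancel R L.
Proof. by move=> c; rewrite (retract_LRC N H) retract_LK. Qed.

Context (a : Y -> Y) (aL : forall c, a (L c) = L (a c)).

Local Notation phi := (twist s p q a).

Lemma retract_twist x : p (phi x) = L (p x).
Proof. exact: retract_s H _ _. Qed.

Lemma commuting_map_R c : a (R c) = R (a c).
Proof. by rewrite -[LHS]retract_LK -aL retract_RK. Qed.

(** A preimage of [y] lies in the class [R (p y)], so the index used by the
    twist at that preimage can be read off from [y], and [s'] undoes it. *)
Lemma twist_bij : bijective phi.
Proof.
exists (fun y => s' (q (a (R (p y)))) y) => y.
  by rewrite retract_twist retract_LK (nybe_sK N).
set w := q (a (R (p y))); rewrite /twist.
have -> : p (s' w y) = R (p y).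
  by rewrite -[LHS]retract_LK -(retract_s H w) (nybe_s'K N).
exact: nybe_s'K N _ _.
Qed.

(** As [phi] acts on classes as [L], the index at [s z x] is the class of
    [s_(phi z) w], where [w] is the index at [x], while [t_w (phi z)] is in the
    class of [z]; so both sides are the two sides of
    [s_(s u w) s_(t w u) = s_u s_w] at [u = phi z]. *)
Lemma twist_s z x : phi (s z x) = s (phi z) (phi x).
Proof.
set w := q (a (p x)).
have sE : s (q (a (p (s z x)))) = s (s (phi z) w).
  apply: (eq_retract_s H).
  by rewrite (retract_section H) !(retract_s H) (retract_section H) aL.
have sE' : s z = s (t w (phi z)).
  by apply: (eq_retract_s H); rewrite (retract_t H) retract_twist retract_LK.
by rewrite [phi (s z x)]/twist sE sE' -(nybe_s N).
Qed.

(** Likewise, up to classes of the indices, this is the mixed Yang-Baxter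
    identity [nybe_st]. *)
Lemma twist_t z x : phi (t z x) = t (phi z) (phi x).
Proof.
set w := q (a (p x)).
have tE : t (phi z) = t (s (t x w) z).
  by apply: (eq_retract_t H); rewrite retract_twist (retract_s H).
have sE : s (q (a (p (t z x)))) = s (t (s x z) w).
  apply: (eq_retract_s H); rewrite (retract_section H) !(retract_t H).
  by rewrite (retract_section H) commuting_map_R.
by rewrite [phi (t z x)]/twist sE tE -(nybe_st N).
Qed.

End PermutationRetractInverse.

(** * Regularity of the automorphism group *)

Lemma automorphisms_comp (S : solution) (f g : S -> S) :
  automorphisms S f -> automorphisms S g -> automorphisms S (f \o g).
Proof.
move=> [bf fs ft] [bg gs gt]; split; first exact: bij_comp.
  move=> x; apply/funext => y /=.
  by have /= -> := congr1 (@^~ y) (gs x); have /= := congr1 (@^~ (g y)) (fs (g x)).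
move=> x; apply/funext => y /=.
by have /= -> := congr1 (@^~ y) (gt x); have /= := congr1 (@^~ (g y)) (ft (g x)).
Qed.

Lemma automorphisms_inv (S : solution) (f g : S -> S) :
  automorphisms S f -> cancel f g -> cancel g f -> automorphisms S g.
Proof.
move=> [_ fs ft] fK gK; split; first by exists f.
  move=> x; apply/funext => y /=; apply: (can_inj fK).
  by have /= -> := congr1 (@^~ (g y)) (fs (g x)); rewrite !gK.
move=> x; apply/funext => y /=; apply: (can_inj fK).
by have /= -> := congr1 (@^~ (g y)) (ft (g x)); rewrite !gK.
Qed.

Section SolutionWithPermutationRetract.
Context (S : solution) (indec : indecomposable S).
Context (s' t' : S -> S -> S) (N : nondegenerate_ybe sigma tau s' t').
Context (Y : Type) (p : S -> Y) (q : Y -> S) (L R : Y -> Y).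
Context (H : retracts_to_permutation sigma tau p q L R).

Let M := nybe_sym N.
Let HM := retracts_to_permutation_sym H.
Let LK := retract_LK N H.
Let RK := retract_RK N H.

Lemma twist_automorphism (a : Y -> Y) :
  (forall c, a (L c) = L (a c)) ->
  automorphisms S (twist sigma p q a) /\ automorphisms S (twist tau p q a).
Proof.
move=> aL; have aR := commuting_map_R N H aL; split; split.
- exact: (twist_bij N H).
- by move=> x; apply/funext => y; apply: (twist_s N H aL).
- by move=> x; apply/funext => y; apply: (twist_t N H aL).
- exact: (twist_bij M HM).
- by move=> x; apply/funext => y; apply: (twist_t M HM aR).
- by move=> x; apply/funext => y; apply: (twist_s M HM aR).
Qed.

(** The map is a power of [L], built one generator at a time. *)
Lemma exists_commuting_map x z :
  exists2 a : Y -> Y, (forall c, a (L c) = L (a c)) & a (p x) = p z.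
Proof.
pose A z := exists2 a : Y -> Y, (forall c, a (L c) = L (a c)) & a (p x) = p z.
suff: A z by [].
have step (K : Y -> Y) u v : (forall c, K (L c) = L (K c)) ->
    p v = K (p u) -> A u -> A v.
  move=> KL pv [a aL au]; exists (K \o a); last by rewrite /= au pv.
  by move=> c; rewrite /= aL KL.
have RL c : R (L c) = L (R c) by rewrite LK RK.
(* R, being inverse to L, undoes a step by sigma, and L a step by tau. *)
apply: (indecomposable_ind (x := x)) => // [w y|w y|].
- split; last by apply: (step L); rewrite ?(retract_s H).
  by apply: (step R); rewrite ?(retract_s H) ?LK.
- split; last by apply: (step R); rewrite ?(retract_t H).
  by apply: (step L); rewrite ?(retract_t H) ?RK.
- by exists id.
Qed.

(** The generators themselves need not be automorphisms: the twist imitating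
    [sigma z] at [x] uses other indices on the other classes. *)
Lemma generators_by_automorphisms z x :
  (exists2 f, automorphisms S f & f x = sigma z x) /\
  (exists2 f, automorphisms S f & f x = tau z x).
Proof.
have [a aL ax] := exists_commuting_map x z.
have [auts autt] := twist_automorphism aL.
have qz : p (q (p z)) = p z by apply: (retract_section H).
split.
  exists (twist sigma p q a) => //.
  by rewrite /twist ax (eq_retract_s H qz).
exists (twist tau p q a) => //.
by rewrite /twist ax (eq_retract_t H qz).
Qed.

Lemma automorphisms_transitive : acts_transitively (automorphisms S).
Proof.
move=> x.
have step u v : (exists2 f, automorphisms S f & f u = v) ->
    (exists2 f, automorphisms S f & f x = v) <->
    (exists2 f, automorphisms S f & f x = u).
  move=> [g Ag <-]; split=> [][f Af fx].
    have [[g' gK g'K] _ _] := Ag.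
    exists (g' \o f); last by rewrite /= fx gK.
    exact: automorphisms_comp (automorphisms_inv Ag gK g'K) Af.
  by exists (g \o f); [apply: automorphisms_comp | rewrite /= fx].
apply: (indecomposable_ind (x := x)) => // [z y|z y|].
- by apply: step; case: (generators_by_automorphisms z y).
- by apply: step; case: (generators_by_automorphisms z y).
- by exists id => //; split=> //; exists id.
Qed.

(** Transitivity is used twice: first to see that [f] fixes every class, then,
    since [f] now commutes with the generators, that it fixes every point. *)
Lemma automorphisms_free x f : automorphisms S f -> f x = x -> f = id.
Proof.
move=> [_ fs ft] fx.
have fsE z y : f (sigma z y) = sigma (f z) (f y).
  by have /= := congr1 (@^~ y) (fs z).
have ftE z y : f (tau z y) = tau (f z) (f y).
  by have /= := congr1 (@^~ y) (ft z).
have pf : forall y, p (f y) = p y.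
  apply: (indecomposable_ind (x := x)) => // [z y|z y|]; last by rewrite fx.
    rewrite fsE !(retract_s H).
    by split=> [/(can_inj LK)|->].
  rewrite ftE !(retract_t H).
  by split=> [/(can_inj RK)|->].
apply/funext/(indecomposable_ind (x := x)) => // z y.
  rewrite fsE (eq_retract_s H (pf z)).
  by split=> [/(can_inj (nybe_sK N z))|->].
rewrite ftE (eq_retract_t H (pf z)).
by split=> [/(can_inj (nybe_tK N z))|->].
Qed.

End SolutionWithPermutationRetract.

Lemma ret_retracts_to_permutation (S : solution) :
  one_element (Ret (Ret S)) ->
  exists L R : Ret S -> Ret S,
    retracts_to_permutation sigma tau (@retract_pi S) (@retract_repr S) L R.
Proof.
move=> [c0 c0P]; have [b0] := carrier_inhabited (Ret S).
have opE (b : Ret S) : sigma b = sigma b0 /\ tau b = tau b0.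
  by apply/retract_piP; rewrite [LHS]c0P [RHS]c0P.
exists (sigma b0), (tau b0); split; first exact: retract_piP.
- exact: retract_reprK.
- by move=> x y; rewrite -(opE (retract_pi x)).1 -[LHS]retract_sigmaE.
- by move=> x y; rewrite -(opE (retract_pi x)).2 -[LHS]retract_tauE.
Qed.

Theorem proposition4p10 (S : solution) (indec : indecomposable S)
    (mpl2 : multipermutation_level_2 S) :
  acts_regularly (automorphisms S).
Proof.
have [s' [t' N]] := solution_nybe S.
have [L [R H]] := ret_retracts_to_permutation mpl2.2.
split; first exact: (automorphisms_transitive indec N H).
exact: (automorphisms_free indec N H).
Qed.
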